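(* Let $\Psi$ be a commuting interaction on a finite graph $\Lambda$. For all $X\subset\Lambda'\subset\Lambda$, all $A\in\mathcal{A}_X$ and all $t\in\mathbb{R}$, $$\big\|\tau^\Lambda_t(A)-\tau^{\Lambda'}_t(A)\big\|\le 2\,\|A\|\,|t|\sum_{\substack{Z\subset\Lambda:\ Z\cap X\neq\emptyset,\\ Z\cap(\Lambda\setminus\Lambda')\neq\emptyset}}\|\Psi(Z)\|.$$ Moreover, if $\|\Psi\|_F<\infty$ for some decaying function $F:[0,\infty)\to(0,\infty)$, then $$\big\|\tau^\Lambda_t(A)-\tau^{\Lambda'}_t(A)\big\|\le 2\,\|A\|\,\|\Psi\|_F\,|t|\sum_{x\in X}\sum_{y\in\Lambda\setminus\Lambda'}F(d(x,y)).$$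
   Context: $\Lambda$ has graph distance $d$. Each site carries $\mathbb{C}^q$, $\mathcal{A}_Z=\mathcal{B}(\bigotimes_{x\in Z}\mathbb{C}^q)$ embedded in $\mathcal{A}_\Lambda$ via $A\mapsto A\otimes\mathbf{1}$. An interaction assigns to each $Z\subset\Lambda$ a self-adjoint $\Psi(Z)\in\mathcal{A}_Z$; commuting means $[\Psi(Z),\Psi(Z')]=0$ for all $Z,Z'$. $\|\Psi\|_F=\sup_{x,y\in\Lambda}\sum_{Z\ni x,y}\|\Psi(Z)\|/F(d(x,y))$. For $\Lambda'\subset\Lambda$, $H_{\Lambda'}=\sum_{Z\subset\Lambda'}\Psi(Z)$ and $\tau^{\Lambda'}_t(A)=e^{itH_{\Lambda'}}Ae^{-itH_{\Lambda'}}$. *)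

(* Defs.v *)
(* with MathComp-Analysis reals and real_closed complex numbers. *)
From HB Require Import structures.
From mathcomp Require Import all_boot all_order all_algebra.
From mathcomp Require Import all_classical all_reals.
From mathcomp Require Import topology normedtype sequences.
From mathcomp Require Import complex.
Set Implicit Arguments. Unset Strict Implicit. Unset Printing Implicit Defensive.
Import Order.TTheory GRing.Theory Num.Theory.
Import numFieldTopology.Exports numFieldNormedType.Exports.
Local Open Scope ring_scope.
Local Open Scope classical_set_scope.

(* ---------------- graph distance on a finite graph ---------------- *)
Section Graph.
Variable T : finType.
Variable e : rel T.

(* vertices reachable from x in at most n steps *)
Fixpoint reach (n : nat) (x : T) : {set T} :=
  if n is n'.+1 then
    reach n' x :|: [set z | [exists w in reach n' x, e w z]]
  else [set x].

Definition simple_graph : Prop := irreflexive e /\ symmetric e.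
Definition connected_graph : Prop := forall x y : T, connect e x y.

(* graph distance: least n with y reachable from x in n steps
   (on a connected graph this is < #|T|) *)
Definition gdist (x y : T) : nat :=
  find (fun n => y \in reach n x) (iota 0 #|T|).
End Graph.

(* ---------------- Hilbert space of the finite spin system ---------------- *)
Section Ops.
Variable R : realType.
Local Notation C := R[i].
Variable T : finType.
Variable q : nat.

Definition conf := {ffun T -> 'I_q}.
Definition dimH := #|{: conf}|.
Definition op := 'M[C]_dimH.
Definition cfg (i : 'I_dimH) : conf := enum_val i.

(* A is (the embedding A (x) 1 of) an element of A_Z *)
Definition local_on (Z : {set T}) (A : op) : Prop :=
  (forall i j, (exists2 x, x \notin Z & cfg i x != cfg j x) -> A i j = 0) /\
  (forall i j i' j',
      (forall x, x \in Z -> cfg i x = cfg i' x) ->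
      (forall x, x \in Z -> cfg j x = cfg j' x) ->
      (forall x, x \notin Z -> cfg i x = cfg j x) ->
      (forall x, x \notin Z -> cfg i' x = cfg j' x) ->
      A i j = A i' j').

Definition adj (A : op) : op := \matrix_(i, j) ((A j i)^*)%C.
Definition self_adjoint (A : op) : Prop := adj A = A.

(* Euclidean norm of a vector and operator norm *)
Definition vnorm (v : 'cV[C]_dimH) : R :=
  Num.sqrt (\sum_i (complex.Re (v i 0) ^+ 2 + complex.Im (v i 0) ^+ 2)).
Definition opnorm (A : op) : R :=
  sup [set vnorm (A *m v) | v in [set v : 'cV[C]_dimH | vnorm v <= 1]].

(* matrix exponential, entrywise limit of the partial sums of the series *)
Definition expm (M : op) : op :=
  let S n := \sum_(k < n) ((k`!%:R)^-1 *: M ^+ k) in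
  \matrix_(i, j)
    (lim ((fun n => complex.Re (S n i j)) @ \oo)
      +i* lim ((fun n => complex.Im (S n i j)) @ \oo))%C.

(* interactions *)
Definition interaction := {set T} -> op.
Definition is_interaction (Psi : interaction) : Prop :=
  forall Z, self_adjoint (Psi Z) /\ local_on Z (Psi Z).
Definition commuting (Psi : interaction) : Prop :=
  forall Z Z', Psi Z *m Psi Z' = Psi Z' *m Psi Z.

Definition ham (Psi : interaction) (L' : {set T}) : op :=
  \sum_(Z : {set T} | Z \subset L') Psi Z.

(* tau^{L'}_t (A) = e^{i t H_{L'}} A e^{- i t H_{L'}} *)
Definition tau (Psi : interaction) (L' : {set T}) (t : R) (A : op) : op :=
  expm ((t%:C * 'i)%C *: ham Psi L') *m A *m expm (((- t)%:C * 'i)%C *: ham Psi L').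

(* decaying function F : [0,oo) -> (0,oo): positive and non-increasing *)
Definition decaying (F : R -> R) : Prop :=
  (forall r, 0 <= r -> 0 < F r) /\ (forall r s, 0 <= r -> r <= s -> F s <= F r).

(* ||Psi||_F = sup_{x,y} sum_{Z ∋ x,y} ||Psi Z|| / F (d x y)   (finite sup) *)
Definition normF (e : rel T) (F : R -> R) (Psi : interaction) : R :=
  \big[Num.max/0]_(p : T * T)
     ((\sum_(Z : {set T} | (p.1 \in Z) && (p.2 \in Z)) opnorm (Psi Z))
        / F (gdist e p.1 p.2)%:R).
End Ops.

(* Main.v *)
Require Import Defs.
From mathcomp Require Import all_boot all_order all_algebra.
From mathcomp Require Import all_classical all_reals.
From mathcomp Require Import topology normedtype sequences exp.
From mathcomp Require Import complex.
From mathcomp Require Import ring lra.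
Import Order.TTheory GRing.Theory Num.Theory.
Import numFieldTopology.Exports numFieldNormedType.Exports.
Local Open Scope ring_scope.

(** Write H_Lambda = H_Lambda' + W + V, where W collects the terms meeting both
    X and the complement of Lambda', and V the remaining terms not contained in
    Lambda', all supported away from X.  The three parts commute, so the
    exponential factorizes; e^(itV) commutes with A and cancels, leaving
    e^(itH_Lambda') (e^(itW) A e^(-itW) - A) e^(-itH_Lambda').  Unitarity bounds
    its norm by 2 |A| |e^(itW) - 1| <= 2 |A| |t| |W|.  For the second bound, a
    set Z in W contains some pair x in X, y outside Lambda'; sum over pairs. *)

(** * Euclidean norm of vectors and operator norm of matrices *)

Section OperatorNorm.
Context {R : realType} {T : finType} {q : nat}.
Implicit Types (A B M N : op R T q) (v w : 'cV[R[i]]_(dimH T q)) (z : R[i]).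

(** The complex modulus as an element of [R]: the library norm of [z] lives in [R[i]], whereas
    [vnorm] and [opnorm] are real. *)
Definition cabs z : R := Num.sqrt (complex.Re z ^+ 2 + complex.Im z ^+ 2).

Lemma cabsE z : (cabs z)%:C%C = `|z|. Proof. by rewrite normc_def. Qed.

Lemma cabs_ge0 z : 0 <= cabs z. Proof. exact: sqrtr_ge0. Qed.

Lemma sqr_cabs z : cabs z ^+ 2 = complex.Re z ^+ 2 + complex.Im z ^+ 2.
Proof. by rewrite sqr_sqrtr // addr_ge0 ?sqr_ge0. Qed.

Lemma cabsM z z' : cabs (z * z') = cabs z * cabs z'.
Proof. by have := normrM z z'; rewrite -!cabsE -rmorphM => -[]. Qed.

Lemma cabs_real (x : R) : cabs x%:C%C = `|x|.
Proof. by rewrite /cabs /= expr0n addr0 sqrtr_sqr. Qed.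

Lemma cabs_it (t : R) : cabs (t%:C * 'i)%C = `|t|.
Proof. by rewrite /cabs /= !mulr0 mul0r mulr1 addr0 subr0 expr0n add0r sqrtr_sqr. Qed.

Lemma normr_Re_le_cabs z : `|complex.Re z| <= cabs z.
Proof. by rewrite -sqrtr_sqr ler_sqrt ?lerDl ?sqr_ge0 // addr_ge0 ?sqr_ge0. Qed.

Lemma normr_Im_le_cabs z : `|complex.Im z| <= cabs z.
Proof. by rewrite -sqrtr_sqr ler_sqrt ?lerDr ?sqr_ge0 // addr_ge0 ?sqr_ge0. Qed.

Lemma cabs_le_ReIm z : cabs z <= `|complex.Re z| + `|complex.Im z|.
Proof.
rewrite -(@ler_pXn2r _ 2) ?nnegrE ?cabs_ge0 ?addr_ge0 // sqr_cabs sqrrD.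
by rewrite !real_normK ?num_real // lerD2r lerDl mulrn_wge0 ?mulr_ge0.
Qed.

Lemma vnorm_ge0 v : 0 <= vnorm v. Proof. exact: sqrtr_ge0. Qed.

Lemma sqr_vnorm v : vnorm v ^+ 2 = \sum_i cabs (v i 0) ^+ 2.
Proof.
rewrite sqr_sqrtr; last by apply: sumr_ge0 => i _; rewrite addr_ge0 ?sqr_ge0.
by apply: eq_bigr => i _; rewrite sqr_cabs.
Qed.

Lemma vnorm0 : vnorm (0 : 'cV[R[i]]_(dimH T q)) = 0.
Proof.
by apply/eqP; rewrite -sqrf_eq0 sqr_vnorm big1 // => i _; rewrite mxE sqr_cabs expr0n addr0.
Qed.

Lemma vnorm_eq0 v : vnorm v = 0 -> v = 0.
Proof.
move=> v0; have /eqP := sqr_vnorm v; rewrite v0 expr0n eq_sym.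
rewrite psumr_eq0 => [|i _]; last exact: sqr_ge0.
move=> /allP H; apply/matrixP => i j; rewrite ord1 mxE.
have := H i (mem_index_enum i); rewrite sqrf_eq0 => /eqP ci.
by apply/eqP; rewrite -normr_eq0 -cabsE ci.
Qed.

Lemma vnormZ z v : vnorm (z *: v) = cabs z * vnorm v.
Proof.
apply/eqP; rewrite -(@eqrXn2 _ 2) ?mulr_ge0 ?vnorm_ge0 ?cabs_ge0 //.
rewrite exprMn !sqr_vnorm mulr_sumr; apply/eqP/eq_bigr => i _.
by rewrite mxE cabsM exprMn.
Qed.

Lemma vnorm_entry v i : cabs (v i 0) <= vnorm v.
Proof.
rewrite -(@ler_pXn2r _ 2) ?nnegrE ?cabs_ge0 ?vnorm_ge0 // sqr_vnorm.
by rewrite (bigD1 i) //= lerDl sumr_ge0 // => j _; exact: sqr_ge0.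
Qed.

(** The real part of the Hermitian inner product, that is, the Euclidean inner product after
    identifying each complex coordinate with a pair of reals. *)
Definition re_dot v w : R :=
  \sum_i (complex.Re (v i 0) * complex.Re (w i 0)
          + complex.Im (v i 0) * complex.Im (w i 0)).

Lemma sqr_vnormZD (a b : R) v w :
  vnorm (a%:C%C *: v + b%:C%C *: w) ^+ 2
  = a ^+ 2 * vnorm v ^+ 2 + 2 * a * b * re_dot v w + b ^+ 2 * vnorm w ^+ 2.
Proof.
rewrite !sqr_vnorm /re_dot !mulr_sumr -!big_split; apply: eq_bigr => i _.
rewrite !mxE !sqr_cabs; case: (v i 0) => x y; case: (w i 0) => x' y' /=.
ring.
Qed.

(** Cauchy-Schwarz: for nonzero vectors, expand the nonnegative square of the norm of |w| v - |v| w
    and divide by |v| |w|. *)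
Lemma re_dot_le v w : re_dot v w <= vnorm v * vnorm w.
Proof.
have [v0|v_neq0] := eqVneq (vnorm v) 0.
  rewrite v0 mul0r /re_dot big1 // => i _.
  by rewrite (vnorm_eq0 _ v0) mxE /= !mul0r addr0.
have [w0|w_neq0] := eqVneq (vnorm w) 0.
  rewrite w0 mulr0 /re_dot big1 // => i _.
  by rewrite (vnorm_eq0 _ w0) mxE /= !mulr0 addr0.
have v_gt0 : 0 < vnorm v by rewrite lt_def v_neq0 vnorm_ge0.
have w_gt0 : 0 < vnorm w by rewrite lt_def w_neq0 vnorm_ge0.
have := sqr_ge0 (vnorm ((vnorm w)%:C%C *: v + (- vnorm v)%:C%C *: w)).
rewrite sqr_vnormZD => H.
have vw_gt0 : 0 < vnorm v * vnorm w by rewrite mulr_gt0.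
rewrite -(ler_pM2l vw_gt0); nra.
Qed.

Lemma vnormD v w : vnorm (v + w) <= vnorm v + vnorm w.
Proof.
rewrite -(@ler_pXn2r _ 2) ?nnegrE ?addr_ge0 ?vnorm_ge0 //.
have := sqr_vnormZD 1 1 v w; rewrite !scale1r => ->.
have := re_dot_le v w; nra.
Qed.

Lemma vnorm_sum (I : finType) (P : pred I) (f : I -> 'cV[R[i]]_(dimH T q)) :
  vnorm (\sum_(i | P i) f i) <= \sum_(i | P i) vnorm (f i).
Proof.
elim/big_ind2 : _ => [|v x w y vx wy|//]; first by rewrite vnorm0.
by rewrite (le_trans (vnormD _ _)) // lerD.
Qed.

(** A crude bound, from writing [A *m v] as a combination of the columns of [A]; it serves to show
    that the supremum in [opnorm] is finite. *)
Lemma vnorm_mulmx_bound A v :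
  vnorm (A *m v) <= (\sum_j vnorm (col j A)) * vnorm v.
Proof.
have -> : A *m v = \sum_j v j 0 *: col j A.
  apply/matrixP => i k; rewrite ord1 mxE summxE; apply: eq_bigr => j _.
  by rewrite !mxE mulrC.
rewrite (le_trans (vnorm_sum _ _ _)) // mulr_suml; apply: ler_sum => j _.
by rewrite vnormZ mulrC ler_wpM2l ?vnorm_ge0 // vnorm_entry.
Qed.

Let unit_image A :=
  ([set vnorm (A *m v) | v in [set v : 'cV[R[i]]_(dimH T q) | vnorm v <= 1]])%classic.

(** [sup] is a genuine least upper bound only for nonempty bounded sets; the two basic properties of
    [opnorm], [vnorm_mulmx] and [opnorm_le], rest on this. *)
Lemma unit_image_has_sup A : has_sup (unit_image A).
Proof.
split; first by exists (vnorm (A *m 0)), 0 => //=; rewrite vnorm0.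
exists (\sum_j vnorm (col j A)) => _ [v /= v1 <-].
rewrite (le_trans (vnorm_mulmx_bound A v)) // -[leRHS]mulr1 ler_wpM2l //.
by apply: sumr_ge0 => j _; exact: vnorm_ge0.
Qed.

Lemma opnorm_ge0 A : 0 <= opnorm A.
Proof.
apply: ub_le_sup; first by case: (unit_image_has_sup A).
by exists 0; rewrite /= ?mulmx0 vnorm0.
Qed.

Lemma vnorm_mulmx A v : vnorm (A *m v) <= opnorm A * vnorm v.
Proof.
have [v0|v_neq0] := eqVneq (vnorm v) 0.
  by rewrite v0 mulr0 (vnorm_eq0 _ v0) mulmx0 vnorm0.
have v_gt0 : 0 < vnorm v by rewrite lt_def v_neq0 vnorm_ge0.
rewrite -ler_pdivrMr //.
have cV : cabs ((vnorm v)^-1)%:C%C = (vnorm v)^-1.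
  by rewrite cabs_real ger0_norm // invr_ge0 vnorm_ge0.
apply: ub_le_sup; first by case: (unit_image_has_sup A).
exists (((vnorm v)^-1)%:C%C *: v) => /=.
  by rewrite vnormZ cV mulVf.
by rewrite -scalemxAr vnormZ cV mulrC.
Qed.

Lemma opnorm_le A (K : R) :
  (forall v, vnorm (A *m v) <= K * vnorm v) -> 0 <= K -> opnorm A <= K.
Proof.
move=> HK K0; apply: ge_sup; first by case: (unit_image_has_sup A).
move=> _ [v /= v1 <-]; rewrite (le_trans (HK v)) //.
by rewrite -[leRHS]mulr1 ler_wpM2l.
Qed.

Lemma opnormD A B : opnorm (A + B) <= opnorm A + opnorm B.
Proof.
apply: opnorm_le => [v|]; last by rewrite addr_ge0 ?opnorm_ge0.
by rewrite mulmxDl mulrDl (le_trans (vnormD _ _)) // lerD ?vnorm_mulmx.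
Qed.

Lemma opnormM A B : opnorm (A *m B) <= opnorm A * opnorm B.
Proof.
apply: opnorm_le => [v|]; last by rewrite mulr_ge0 ?opnorm_ge0.
rewrite -mulmxA -mulrA (le_trans (vnorm_mulmx _ _)) //.
by rewrite ler_wpM2l ?opnorm_ge0 ?vnorm_mulmx.
Qed.

Lemma opnorm0 : opnorm (0 : op R T q) = 0.
Proof.
apply/eqP; rewrite eq_le opnorm_ge0 andbT; apply: opnorm_le => // v.
by rewrite mul0mx vnorm0 mul0r.
Qed.

Lemma opnormZ_le z A : opnorm (z *: A) <= cabs z * opnorm A.
Proof.
apply: opnorm_le => [v|]; last by rewrite mulr_ge0 ?opnorm_ge0 ?cabs_ge0.
by rewrite -scalemxAl vnormZ -mulrA ler_wpM2l ?cabs_ge0 ?vnorm_mulmx.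
Qed.

Lemma opnormN A : opnorm (- A) = opnorm A.
Proof.
have le B : opnorm (- B) <= opnorm B.
  apply: opnorm_le (opnorm_ge0 B) => v.
  have := vnormZ (-1)%:C%C (B *m v).
  by rewrite cabs_real normrN1 mul1r rmorphN scaleN1r mulNmx => ->; exact: vnorm_mulmx.
by apply/eqP; rewrite eq_le le -{1}[A]opprK le.
Qed.

(** Equality fails when [q = 0] and [T] is nonempty: the space is then zero-dimensional and its
    identity has norm 0. *)
Lemma opnorm1 : opnorm (1%:M : op R T q) <= 1.
Proof. by apply: opnorm_le => // v; rewrite mul1mx mul1r. Qed.

Lemma opnorm_sum (I : finType) (P : pred I) (f : I -> op R T q) :
  opnorm (\sum_(i | P i) f i) <= \sum_(i | P i) opnorm (f i).
Proof.
elim/big_ind2 : _ => [|A x B y Ax By|//]; first by rewrite opnorm0.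
by rewrite (le_trans (opnormD _ _)) // lerD.
Qed.

Lemma opnormX A k : opnorm (A ^+ k) <= opnorm A ^+ k.
Proof.
elim: k => [|k IHk]; first by rewrite !expr0 opnorm1.
by rewrite !exprS (le_trans (opnormM _ _)) // ler_wpM2l ?opnorm_ge0.
Qed.

(** Apply [A] to the basis vector [j], of norm 1, and read off coordinate [i]. *)
Lemma opnorm_entry A i j : cabs (A i j) <= opnorm A.
Proof.
have e1 : vnorm (delta_mx j 0 : 'cV[R[i]]_(dimH T q)) = 1.
  apply/eqP; rewrite -(@eqrXn2 _ 2) ?vnorm_ge0 // sqr_vnorm (bigD1 j) //=.
  rewrite big1 ?addr0 => [|k kj].
    by rewrite mxE !eqxx sqr_cabs /= expr0n addr0.
  by rewrite mxE (negPf kj) /= sqr_cabs /= !expr0n addr0.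
have := le_trans (vnorm_entry _ i) (vnorm_mulmx A (delta_mx j 0)).
by rewrite e1 mulr1 -colE mxE.
Qed.

(** With [opnorm_entry], this makes norm convergence equivalent to the entrywise convergence by
    which [expm] is defined. *)
Lemma opnorm_le_entries A : opnorm A <= \sum_i \sum_j cabs (A i j).
Proof.
apply: opnorm_le => [v|]; last first.
  by apply: sumr_ge0 => i _; apply: sumr_ge0 => j _; exact: cabs_ge0.
rewrite (le_trans (vnorm_mulmx_bound A v)) // ler_wpM2r ?vnorm_ge0 //.
rewrite exchange_big; apply: ler_sum => j _.
(* Expand the column in the standard basis, whose vectors have norm 1. *)
rewrite [X in vnorm X](_ : _ = \sum_i A i j *: delta_mx i 0); last first.
  apply/matrixP => i k; rewrite ord1 summxE (bigD1 i) //= big1 ?addr0 => [|l li].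
    by rewrite !mxE !eqxx mulr1.
  by rewrite !mxE eq_sym (negPf li) mulr0.
rewrite (le_trans (vnorm_sum _ _ _)) //; apply: ler_sum => i _.
rewrite vnormZ -[leRHS]mulr1 ler_wpM2l ?cabs_ge0 //.
rewrite -(@ler_pXn2r _ 2) ?nnegrE ?vnorm_ge0 // sqr_vnorm (bigD1 i) //=.
rewrite big1 ?addr0 => [|k ki].
  by rewrite mxE !eqxx sqr_cabs /= !expr0n addr0.
by rewrite mxE (negPf ki) /= sqr_cabs /= !expr0n addr0.
Qed.

Lemma sqr_vnorm_adj v : ((vnorm v ^+ 2)%:C)%C = ((map_mx conjc v)^T *m v) 0 0.
Proof.
rewrite sqr_vnorm rmorph_sum mxE; apply: eq_bigr => i _ /=.
by rewrite !mxE mulrC -sqr_normc -cabsE -rmorphXn.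
Qed.

Lemma adjE A : adj A = (map_mx conjc A)^T.
Proof. by apply/matrixP => i j; rewrite !mxE. Qed.

(** The squared norm of A v is v* A* A v = v* v, compared in [R[i]] where this matrix product
    lives. *)
Lemma opnorm_isometry A : adj A *m A = 1%:M -> opnorm A <= 1.
Proof.
move=> AA; apply: opnorm_le => // v; rewrite mul1r.
rewrite -(@ler_pXn2r _ 2) ?nnegrE ?vnorm_ge0 // -lecR.
rewrite !sqr_vnorm_adj map_mxM trmx_mul -adjE -mulmxA (mulmxA (adj A)) AA.
by rewrite mul1mx.
Qed.

End OperatorNorm.

(** * Convergence of matrix sequences in operator norm *)

Section OperatorConvergence.
Context {R : realType} {T : finType} {q : nat}.
Implicit Types (A M N l : op R T q) (u w : nat -> op R T q).

Definition opcvg u l := ((fun n => opnorm (u n - l)) @ \oo --> (0 : R))%classic.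

Lemma opcvg_le u l (b : nat -> R) :
  (forall n, opnorm (u n - l) <= b n) -> (b @ \oo --> (0 : R))%classic ->
  opcvg u l.
Proof.
move=> ub b0; apply: (@squeeze_cvgr _ _ _ _ (fun=> 0) b) => //.
  by apply: nearW => n; rewrite opnorm_ge0 ub.
exact: cvg_cst.
Qed.

Lemma cvg_sum0 (I : finType) (f : I -> nat -> R) :
  (forall i, (f i @ \oo --> (0 : R))%classic) ->
  ((fun n => \sum_i f i n) @ \oo --> (0 : R))%classic.
Proof.
move=> f0; elim: (index_enum I) => [|i s IHs].
  rewrite [X in (X @ _)%classic](_ : _ = fun=> 0); first exact: cvg_cst.
  by apply/funext => n; rewrite big_nil.
rewrite [X in (X @ _)%classic](_ : _ = f i \+ (fun n => \sum_(j <- s) f j n)); last first.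
  by apply/funext => n; rewrite big_cons.
have := cvgD (f0 i) IHs; rewrite addr0; exact.
Qed.

Lemma opcvg_entries u l :
  (forall i j, ((fun n => complex.Re (u n i j)) @ \oo
                --> complex.Re (l i j))%classic) ->
  (forall i j, ((fun n => complex.Im (u n i j)) @ \oo
                --> complex.Im (l i j))%classic) ->
  opcvg u l.
Proof.
move=> reul imul.
have sub_cvg0 (f : nat -> R) c : (f @ \oo --> c)%classic ->
    ((fun n => `|f n - c|) @ \oo --> (0 : R))%classic.
  by move=> fc; have := cvg_norm (cvgB fc (cvg_cst c)); rewrite subrr normr0; exact.
apply: (@opcvg_le _ _ (fun n => \sum_i \sum_j
  (`|complex.Re (u n i j) - complex.Re (l i j)|
   + `|complex.Im (u n i j) - complex.Im (l i j)|))).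
  move=> n; rewrite (le_trans (opnorm_le_entries _)) //.
  apply: ler_sum => i _; apply: ler_sum => j _.
  by rewrite (le_trans (cabs_le_ReIm _)) // !mxE; case: (u n i j); case: (l i j).
apply: cvg_sum0 => i; apply: cvg_sum0 => j.
by have := cvgD (sub_cvg0 _ _ (reul i j)) (sub_cvg0 _ _ (imul i j)); rewrite addr0; exact.
Qed.

(** The shift to [u n.+1] skips the empty partial sum of the exponential series, which does not yet
    contain the constant term. *)
Lemma opcvg_le_opnorm u l c (K : R) :
  opcvg u l -> (forall n, opnorm (u n.+1 - c) <= K) -> opnorm (l - c) <= K.
Proof.
move=> /cvgr0Pnorm_lt ul uc; apply/ler_addgt0Pr => e e0.
have [n _ /(_ n.+1 (leqnSn n))] := ul e e0.
rewrite ger0_norm ?opnorm_ge0 // -opnormN => ue.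
have -> : l - c = (u n.+1 - c) + - (u n.+1 - l).
  by rewrite opprB [RHS]addrC addrA subrK.
by rewrite (le_trans (opnormD _ _)) // lerD // ltW.
Qed.

Lemma opnorm_eq0 A : opnorm A <= 0 -> A = 0.
Proof.
move=> A0; apply/matrixP => i j; rewrite mxE; apply/eqP.
rewrite -normr_eq0 -cabsE.
suff -> : cabs (A i j) = 0 by [].
by apply/eqP; rewrite eq_le cabs_ge0 andbT (le_trans (opnorm_entry A i j)).
Qed.

Lemma opcvg_unique u l l' : opcvg u l -> opcvg u l' -> l = l'.
Proof.
move=> ul ul'; apply/eqP; rewrite -subr_eq0; apply/eqP/opnorm_eq0.
have : ((fun n => opnorm (u n - l) + opnorm (u n - l')) @ \oo --> (0 : R))%classic.
  by have := cvgD ul ul'; rewrite addr0; exact.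
move=> /cvgr0Pnorm_lt H; apply/ler_addgt0Pr => e e0.
have [n _ /(_ n (leqnn n))] := H e e0.
rewrite /= ger0_norm ?addr_ge0 ?opnorm_ge0 // add0r => /ltW; apply: le_trans.
have -> : l - l' = - (u n - l) + (u n - l') by rewrite opprB addrA subrK.
by rewrite -[opnorm (u n - l)]opnormN; exact: opnormD.
Qed.

Lemma opcvgM u w l l' :
  opcvg u l -> opcvg w l' -> opcvg (fun n => u n *m w n) (l *m l').
Proof.
move=> ul wl; apply: (@opcvg_le _ _ (fun n =>
  opnorm (u n - l) * opnorm (w n - l') + opnorm l * opnorm (w n - l')
  + opnorm (u n - l) * opnorm l')).
  (* Expanding around both limits puts an error factor in every summand, so no separate bound on [u]
     or [w] is required. *)
  move=> n; have -> : u n *m w n - l *m l' =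
      (u n - l) *m (w n - l') + l *m (w n - l') + (u n - l) *m l'.
    by rewrite -mulmxDl subrK mulmxBr mulmxBl addrA subrK.
  rewrite (le_trans (opnormD _ _)) // lerD ?opnormM //.
  by rewrite (le_trans (opnormD _ _)) // lerD ?opnormM.
have := cvgD (cvgD (cvgM ul wl) (cvgM (cvg_cst (opnorm l)) wl))
             (cvgM ul (cvg_cst (opnorm l'))).
rewrite !mulr0 mul0r !addr0; exact.
Qed.

Lemma opcvg_cst A : opcvg (fun=> A) A.
Proof. by rewrite /opcvg subrr opnorm0; exact: cvg_cst. Qed.

End OperatorConvergence.

(** * Rearrangement of finite double sums for the Cauchy product *)

Section TriangularSum.
Variable V : zmodType.

(** Sums one triangle by antidiagonals and by rows. Passing from [n] to [n.+1] adds the antidiagonal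
    j + k = n, which is one new entry at the end of each row. *)
Lemma big_triangle (G : nat -> nat -> V) (n : nat) :
  \sum_(0 <= m < n) \sum_(0 <= j < m.+1) G j (m - j)%N =
  \sum_(0 <= j < n) \sum_(0 <= k < n - j) G j k.
Proof.
elim: n => [|n IHn]; first by rewrite !big_geq.
rewrite big_nat_recr //= IHn [RHS]big_nat_recr //= [X in _ + X]big_nat_recr //=.
rewrite addrA -big_split subSnn big_nat1 subnn; congr (_ + _).
apply: eq_big_nat => j /andP[_ jn].
by rewrite subSn ?(ltnW jn) // big_nat_recr.
Qed.

(** Isolates the remainder of the Cauchy product: the entries of the square with j + k at least
    [n]. *)
Lemma big_square_triangle (G : nat -> nat -> V) (n : nat) :
  \sum_(0 <= j < n) \sum_(0 <= k < n) G j k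
  - \sum_(0 <= m < n) \sum_(0 <= j < m.+1) G j (m - j)%N =
  \sum_(0 <= j < n) \sum_(n - j <= k < n) G j k.
Proof.
rewrite big_triangle -sumrB; apply: eq_bigr => j _.
by rewrite (@big_cat_nat _ _ _ (n - j)%N 0%N n) //= ?leq_subr // [X in X - _]addrC addrK.
Qed.

End TriangularSum.

(** Turns binomial expansions into convolutions of exponential coefficients, over [R[i]] for
    matrices and over [R] for their norms. *)
Lemma invf_fact_bin (K : numFieldType) (m j : nat) : (j <= m)%N ->
  (m`!%:R^-1 * 'C(m, j)%:R : K) = j`!%:R^-1 * (m - j)`!%:R^-1.
Proof.
move=> jm; have nz k : (k`!%:R != 0 :> K) by rewrite pnatr_eq0 -lt0n fact_gt0.
rewrite -(bin_fact jm) !natrM.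
have C0 : ('C(m, j)%:R != 0 :> K) by rewrite pnatr_eq0 -lt0n bin_gt0.
by field; rewrite C0 !nz.
Qed.

(** * The matrix exponential and its norm estimates *)

Section OperatorExponential.
Context {R : realType} {T : finType} {q : nat}.
Implicit Types (A M N : op R T q).

Definition expterm M k : op R T q := (k`!%:R)^-1 *: M ^+ k.
Definition expsum n M : op R T q := \sum_(k < n) expterm M k.

Lemma opnorm_expterm M k : opnorm (expterm M k) <= exp_coeff (opnorm M) k.
Proof.
rewrite (le_trans (opnormZ_le _ _)) // /exp_coeff /= mulrC.
have -> : ((k`!%:R)^-1 : R[i]) = ((k`!%:R)^-1 : R)%:C%C.
  by rewrite fmorphV rmorph_nat.
rewrite cabs_real ger0_norm ?invr_ge0 ?ler0n //.
by rewrite ler_wpM2r ?invr_ge0 ?ler0n ?opnormX.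
Qed.

(** Absolute convergence by comparison with the real exponential series at [opnorm M]. The map [f]
    stands for the real or the imaginary part. *)
Lemma expsum_entry_cvg (f : {additive R[i] -> R}) M i j :
  (forall z, `|f z| <= cabs z) ->
  cvgn (fun n => f (expsum n M i j)).
Proof.
move=> f_le.
have -> : (fun n => f (expsum n M i j)) = series (fun k => f (expterm M k i j)).
  by apply/funext => n; rewrite /series /= summxE raddf_sum big_mkord.
apply: normed_cvg; apply: (@series_le_cvg _ _ (exp_coeff (opnorm M))).
- by move=> n; exact: normr_ge0.
- by move=> n; apply: exp_coeff_ge0; exact: opnorm_ge0.
- move=> n; rewrite (le_trans (f_le _)) // (le_trans (opnorm_entry _ _ _)) //.
  exact: opnorm_expterm.
- exact: is_cvg_series_exp_coeff.
Qed.

Lemma Re_expsum_cvg M i j : cvgn (fun n => complex.Re (expsum n M i j)).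
Proof. exact: (@expsum_entry_cvg (@complex.Re R) M i j (@normr_Re_le_cabs R)). Qed.

Lemma Im_expsum_cvg M i j : cvgn (fun n => complex.Im (expsum n M i j)).
Proof. exact: (@expsum_entry_cvg (@complex.Im R) M i j (@normr_Im_le_cabs R)). Qed.

Lemma expm_cvg M : opcvg (expsum ^~ M) (expm M).
Proof.
apply: opcvg_entries => i j; rewrite mxE /=.
- exact: Re_expsum_cvg.
- exact: Im_expsum_cvg.
Qed.

(** The constant term cancels the identity, and the norms of the other terms are dominated by the
    real exponential series without its leading 1. *)
Lemma opnorm_expm_sub1 M : opnorm (expm M - 1%:M) <= expR (opnorm M) - 1.
Proof.
apply: (opcvg_le_opnorm _ _ _ _ (expm_cvg M)) => n.
rewrite /expsum big_ord_recl {1}/expterm /= expr0 fact0 invr1 scale1r addrC addKr.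
rewrite (le_trans (opnorm_sum _ _ _)) //.
rewrite lerBrDl.
have -> : expR (opnorm M) = limn (series (exp_coeff (opnorm M))) by [].
(* The scalar series has nonnegative terms, so its partial sums stay below the limit. *)
apply: le_trans (nondecreasing_cvgn_le _ (is_cvg_series_exp_coeff _) n.+1).
  rewrite /series /= big_mkord big_ord_recl {1}/exp_coeff /= expr0 fact0 divr1.
  by rewrite lerD2l; apply: ler_sum => k _; exact: opnorm_expterm.
by apply/nondecreasing_seqP => k; rewrite /series /= big_nat_recr //= lerDl exp_coeff_ge0 ?opnorm_ge0.
Qed.

Lemma expm0 : expm (0 : op R T q) = 1%:M.
Proof.
apply/eqP; rewrite -subr_eq0; apply/eqP/opnorm_eq0.
by have := opnorm_expm_sub1 0; rewrite opnorm0 expR0 subrr.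
Qed.

Lemma expterm_convolution M N m : M *m N = N *m M ->
  \sum_(0 <= j < m.+1) expterm M j *m expterm N (m - j)%N = expterm (M + N) m.
Proof.
move=> MN; rewrite /expterm addrC GRing.exprDn_comm; last exact/esym.
rewrite scaler_sumr big_mkord; apply: eq_bigr => -[j /= jm] _.
rewrite -[_ * _ *+ _]scaler_nat scalerA invf_fact_bin // -scalemxAl -scalemxAr scalerA.
congr (_ *: _); apply: (@GRing.commrX _ _ _ _ _).
exact/commr_sym/commrX.
Qed.

Lemma exp_coeff_convolution (a b : R) m :
  \sum_(0 <= j < m.+1) exp_coeff a j * exp_coeff b (m - j)%N = exp_coeff (a + b) m.
Proof.
rewrite /exp_coeff /= addrC exprDn mulr_suml big_mkord.
apply: eq_bigr => -[j /= jm] _.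
rewrite -[_ *+ _]mulr_natr.
rewrite [RHS](_ : _ = a ^+ j * b ^+ (m - j) * (m`!%:R^-1 * 'C(m, j)%:R)); last by ring.
by rewrite invf_fact_bin // mulrACA mul1r.
Qed.

(* The part of the Cauchy product beyond the triangle is dominated, term by
   term, by the same expression for the scalars |M| and |N|, which tends to 0
   by the functional equation of the real exponential. *)
Lemma expmD M N : M *m N = N *m M -> expm (M + N) = expm M *m expm N.
Proof.
move=> MN; apply: opcvg_unique (opcvgM _ _ _ _ (expm_cvg M) (expm_cvg N)).
pose s a := series (exp_coeff (a : R)).
have le_gap n : opnorm (expsum n M *m expsum n N - expsum n (M + N)) <=
    s (opnorm M) n * s (opnorm N) n - s (opnorm M + opnorm N) n.
  pose G j k := expterm M j *m expterm N k.
  pose g j k := exp_coeff (opnorm M) j * exp_coeff (opnorm N) k.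
  have -> : expsum n M *m expsum n N - expsum n (M + N) =
      \sum_(0 <= j < n) \sum_(n - j <= k < n) G j k.
    rewrite -big_square_triangle; congr (_ - _).
      rewrite /expsum mulmx_suml big_mkord; apply: eq_bigr => j _.
      by rewrite mulmx_sumr big_mkord.
    rewrite /expsum big_mkord; apply: eq_bigr => m _.
    by rewrite expterm_convolution.
  have -> : s (opnorm M) n * s (opnorm N) n - s (opnorm M + opnorm N) n =
      \sum_(0 <= j < n) \sum_(n - j <= k < n) g j k.
    rewrite -big_square_triangle; congr (_ - _).
      rewrite /s /series /= mulr_suml; apply: eq_bigr => j _.
      by rewrite mulr_sumr.
    by rewrite /s /series /=; apply: eq_bigr => m _; rewrite exp_coeff_convolution.
  have opnorm_sum_nat a b (f : nat -> op R T q) :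
      opnorm (\sum_(a <= k < b) f k) <= \sum_(a <= k < b) opnorm (f k).
    elim/big_ind2 : _ => [|A x B y Ax By|//]; first by rewrite opnorm0.
    by rewrite (le_trans (opnormD _ _)) // lerD.
  rewrite (le_trans (opnorm_sum_nat _ _ _)) //; apply: ler_sum => j _.
  rewrite (le_trans (opnorm_sum_nat _ _ _)) //; apply: ler_sum => k _.
  by rewrite (le_trans (opnormM _ _)) // ler_pM ?opnorm_ge0 ?opnorm_expterm.
apply: (@opcvg_le _ _ _ _ _ (fun n =>
  (s (opnorm M) n * s (opnorm N) n - s (opnorm M + opnorm N) n)
  + opnorm (expsum n (M + N) - expm (M + N)))).
  move=> n; have -> : expsum n M *m expsum n N - expm (M + N) =
      (expsum n M *m expsum n N - expsum n (M + N))
      + (expsum n (M + N) - expm (M + N)) by rewrite addrA subrK.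
  by rewrite (le_trans (opnormD _ _)) // lerD2r le_gap.
have s_cvg a : (s a @ \oo --> expR a)%classic by exact: is_cvg_series_exp_coeff.
have := cvgD (cvgB (cvgM (s_cvg (opnorm M)) (s_cvg (opnorm N)))
                   (s_cvg (opnorm M + opnorm N))) (expm_cvg (M + N)).
rewrite expRD subrr addr0; exact.
Qed.

(** Every partial sum commutes with [A], so both sides are limits of the same sequence. *)
Lemma expm_comm M A : M *m A = A *m M -> expm M *m A = A *m expm M.
Proof.
move=> MA.
have MA_cvg := opcvgM _ _ _ _ (expm_cvg M) (opcvg_cst A).
have AM_cvg := opcvgM _ _ _ _ (opcvg_cst A) (expm_cvg M).
apply: opcvg_unique MA_cvg _; rewrite [fun n => _](_ : _ = fun n => A *m expsum n M) //.
apply/funext => n; rewrite /expsum mulmx_suml mulmx_sumr; apply: eq_bigr => k _.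
rewrite /expterm -scalemxAl -scalemxAr; congr (_ *: _).
exact/esym/(@GRing.commrX _ _ _ k (esym MA)).
Qed.

Lemma adjX M k : adj (M ^+ k) = adj M ^+ k.
Proof.
elim: k => [|k IHk].
  by rewrite !expr0 adjE map_mx1 trmx1.
by rewrite exprS exprSr -IHk !adjE -mulmxE map_mxM trmx_mul.
Qed.

Lemma adj_expsum n M i j : expsum n (adj M) i j = (expsum n M j i)^*%C.
Proof.
rewrite /expsum !summxE rmorph_sum; apply: eq_bigr => k _ /=.
rewrite /expterm -adjX !mxE rmorphM; congr (_ * _).
by rewrite fmorphV rmorph_nat.
Qed.

(** Taking adjoints transposes entries, keeps real parts and negates imaginary parts, all compatible
    with limits; uniqueness of the limit concludes. *)
Lemma adj_expm M : adj (expm M) = expm (adj M).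
Proof.
have conv : opcvg (expsum ^~ (adj M)) (adj (expm M)).
  apply: opcvg_entries => i j.
    have -> : (fun n => complex.Re (expsum n (adj M) i j)) =
        (fun n => complex.Re (expsum n M j i)).
      by apply/funext => n; rewrite adj_expsum; case: (expsum n M j i).
    have -> : complex.Re (adj (expm M) i j) = complex.Re (expm M j i).
      by rewrite mxE; case: (expm M j i).
    by rewrite mxE; exact: Re_expsum_cvg.
  have -> : (fun n => complex.Im (expsum n (adj M) i j)) =
      (fun n => - complex.Im (expsum n M j i)).
    by apply/funext => n; rewrite adj_expsum; case: (expsum n M j i).
  have -> : complex.Im (adj (expm M) i j) = - complex.Im (expm M j i).
    by rewrite mxE; case: (expm M j i).
  by rewrite mxE; apply: cvgN (Im_expsum_cvg M j i).
exact: opcvg_unique conv (expm_cvg _).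
Qed.

Lemma expmN_l M : expm (- M) *m expm M = 1%:M.
Proof. by rewrite -expmD ?addNr ?expm0 // mulNmx mulmxN. Qed.

Lemma expmN_r M : expm M *m expm (- M) = 1%:M.
Proof. by rewrite -expmD ?addrN ?expm0 // mulNmx mulmxN. Qed.

(** The adjoint of e^M is e^(-M), its inverse, so e^M is unitary. *)
Lemma opnorm_expm_skew M : adj M = - M -> opnorm (expm M) <= 1.
Proof. by move=> aM; apply: opnorm_isometry; rewrite adj_expm aM expmN_l. Qed.

Lemma expmMn M n : expm (M *+ n) = expm M ^+ n.
Proof.
elim: n => [|n IHn]; first by rewrite mulr0n expm0.
rewrite mulrS exprS expmD ?IHn //.
by rewrite mulmxE; apply: GRing.commrMn.
Qed.

(** Telescoping: A^(n+1) - 1 = A (A^n - 1) + (A - 1), where the contraction [A] does not enlarge the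
    first term. *)
Lemma opnormX_sub1 A n : opnorm A <= 1 ->
  opnorm (A ^+ n - 1%:M) <= n%:R * opnorm (A - 1%:M).
Proof.
move=> A1; elim: n => [|n IHn]; first by rewrite expr0 subrr opnorm0 mul0r.
have -> : A ^+ n.+1 - 1%:M = A *m (A ^+ n - 1%:M) + (A - 1%:M).
  by rewrite exprS mulmxBr mulmx1 addrA subrK.
rewrite (le_trans (opnormD _ _)) // -natr1 mulrDl mul1r lerD2r.
apply: le_trans (opnormM _ _) _; apply: le_trans IHn.
by rewrite -[leRHS]mul1r ler_wpM2r ?opnorm_ge0.
Qed.

(** The inequality 1 - x <= e^(-x) multiplied by e^x; a division-free form of e^x - 1 <= x / (1 -
    x). *)
Lemma expR_sub1_le (x : R) : x < 1 -> (expR x - 1) * (1 - x) <= x.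
Proof.
move=> x1; have := expR_ge1Dx (- x) => H.
have : expR x * (1 - x) <= 1.
  by rewrite -[leRHS](expRxMexpNx_1 x) ler_wpM2l ?expR_ge0.
lra.
Qed.

(** Replaces letting n tend to infinity in K (1 - x/n) <= x by one Archimedean choice of n. *)
Lemma ler_mulrB_nat (K x : R) : 0 <= x ->
  (forall n : nat, x < n%:R -> K * (n%:R - x) <= n%:R * x) -> K <= x.
Proof.
move=> x0 step.
rewrite leNgt; apply/negP => xK.
have Kx : 0 < K - x by rewrite subr_gt0.
have K0 : 0 <= K by lra.
have q0 : 0 <= K * x / (K - x) by rewrite divr_ge0 ?mulr_ge0 // ltW.
(* If K > x, the assumed inequality reads n (K - x) <= K x and fails beyond K x / (K - x); the extra
   [x] also guarantees [x < n%:R]. *)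
pose n := Num.bound (x + K * x / (K - x)).
have : x + K * x / (K - x) < n%:R.
  by apply: archi_boundP; rewrite addr_ge0.
move=> Hn; have xn : x < n%:R by apply: le_lt_trans Hn; rewrite lerDl.
have := step n xn.
have : K * x / (K - x) < n%:R by apply: le_lt_trans Hn; rewrite lerDr.
rewrite ltr_pdivrMr //; nra.
Qed.

(* Splitting into n equal steps of norm at most 1 gives |e^M - 1| <= n (e^(|M|/n) - 1),
   and the right-hand side tends to |M|. *)
Lemma opnorm_expm_skew_sub1 M : adj M = - M -> opnorm (expm M - 1%:M) <= opnorm M.
Proof.
move=> aM; set K := opnorm _; set x := opnorm M.
have K0 : 0 <= K by exact: opnorm_ge0.
have x0 : 0 <= x by exact: opnorm_ge0.
have step n : x < n%:R -> K * (n%:R - x) <= n%:R * x.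
  move=> xn; have n0 : 0 < n%:R :> R by exact: le_lt_trans xn.
  pose c : R[i] := (n%:R^-1 : R)%:C%C.
  pose P := c *: M.
  have MP : M = P *+ n.
    rewrite -scaler_nat scalerA /c fmorphV rmorph_nat mulfV ?scale1r //.
    by rewrite pnatr_eq0 -(@pnatr_eq0 R) gt_eqF.
  have aP : adj P = - P.
    rewrite -scalerN -aM; apply/matrixP => i j; rewrite !mxE rmorphM.
    by congr (_ * _); exact: conjc_real.
  have xP : opnorm P <= x / n%:R.
    rewrite (le_trans (opnormZ_le _ _)) // cabs_real ger0_norm ?invr_ge0 ?ler0n //.
    by rewrite mulrC.
  have KP : K <= n%:R * (expR (x / n%:R) - 1).
    rewrite /K MP expmMn (le_trans (opnormX_sub1 _ _ (opnorm_expm_skew _ aP))) //.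
    rewrite ler_wpM2l ?ler0n // (le_trans (opnorm_expm_sub1 _)) //.
    by rewrite lerD2r ler_expR.
  have y1 : x / n%:R < 1 by rewrite ltr_pdivrMr // mul1r.
  have := expR_sub1_le _ y1; set y := x / n%:R => Hy.
  have -> : x = y * n%:R by rewrite /y divfK // gt_eqF.
  rewrite -{1}[n%:R]mul1r -mulrBl mulrCA [leRHS]mulrC -mulrA.
  (* Multiplying [KP] by [1 - y] lets [Hy] remove the exponential, leaving the form needed by
     [ler_mulrB_nat]. *)
  have : K * (1 - y) <= n%:R * y.
    have y0 : 0 <= 1 - y by rewrite subr_ge0 ltW.
    apply: le_trans (ler_wpM2r y0 KP) _.
    by rewrite -mulrA ler_wpM2l // ltW.
  nra.
exact: (ler_mulrB_nat _ _ x0 step).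
Qed.

End OperatorExponential.

(** * Commutation of operators with disjoint supports *)

Section Locality.
Context {R : realType} {T : finType} {q : nat}.
Implicit Types (A B : op R T q) (X Y : {set T}) (i j : 'I_(dimH T q)).

Definition splice X i j : 'I_(dimH T q) :=
  enum_rank [ffun x => if x \in X then cfg j x else cfg i x].

Lemma cfg_splice X i j x :
  cfg (splice X i j) x = if x \in X then cfg j x else cfg i x.
Proof. by rewrite /cfg enum_rankK ffunE. Qed.

Lemma cfg_inj i j : (forall x, cfg i x = cfg j x) -> i = j.
Proof. by move=> H; apply: enum_val_inj; apply/ffunP. Qed.

(** An intermediate index contributes only if it agrees with [i] off [X] and with [j] off [Y], hence
    with [j] on [X]. This leaves the spliced index alone. *)
Lemma local_mulmx_entry X Y A B i j : local_on X A -> local_on Y B ->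
  [disjoint X & Y] ->
  (A *m B) i j = A i (splice X i j) * B (splice X i j) j.
Proof.
move=> [A0 _] [B0 _] XY; rewrite mxE (bigD1 (splice X i j)) //= big1 ?addr0 //.
move=> k kN; have [/existsP[x xN]|] :=
  boolP [exists x, cfg k x != cfg (splice X i j) x].
  move: xN; rewrite cfg_splice; case: ifPn => xX kx.
    rewrite (B0 k j) ?mulr0 //; exists x => //.
    by rewrite (disjointFr XY xX).
  by rewrite (A0 i k) ?mul0r //; exists x; rewrite // eq_sym.
rewrite negb_exists => /forallP H; case/eqP: kN; apply: cfg_inj => x.
by apply/eqP; rewrite -[_ == _]negbK H.
Qed.

Lemma local_disjoint_comm X Y A B : local_on X A -> local_on Y B ->
  [disjoint X & Y] -> A *m B = B *m A.
Proof.
move=> lA lB XY; have YX : [disjoint Y & X] by rewrite disjoint_sym.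
apply/matrixP => i j.
rewrite (local_mulmx_entry _ _ _ _ _ _ lA lB XY).
rewrite (local_mulmx_entry _ _ _ _ _ _ lB lA YX) mulrC.
have [[A0 A1] [B0 B1]] := (lA, lB).
(* If [i] and [j] differ at a site outside both supports, both products vanish there. *)
have [/existsP[x /and3P[xX xY xij]]|] :=
  boolP [exists x, [&& x \notin X, x \notin Y & cfg i x != cfg j x]].
  rewrite (B0 (splice X i j) j) ?mul0r; last first.
    by exists x => //; rewrite cfg_splice (negPf xX).
  rewrite (A0 (splice Y i j) j) ?mulr0 //.
  by exists x => //; rewrite cfg_splice (negPf xY).
rewrite negb_exists => /forallP H.
have ij x : x \notin X -> x \notin Y -> cfg i x = cfg j x.
  by move=> xX xY; have := H x; rewrite xX xY /= negbK => /eqP.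
(* Otherwise the factors match in pairs: the two entries of [B] have equal configurations on [Y] and
   are diagonal off [Y], and likewise for [A] on [X]. *)
congr (_ * _).
  apply: B1 => x xY; rewrite !cfg_splice ?xY ?(negPf xY) //.
  - by rewrite (disjointFr YX xY).
  - by case: ifPn => // xX; rewrite ij.
apply: A1 => x xX; rewrite !cfg_splice ?xX ?(negPf xX) //.
- by rewrite (disjointFr XY xX).
- by case: ifPn => // xY; rewrite ij.
Qed.

End Locality.

(** * Skew-adjoint exponents, commuting sums and conjugation *)

Section SkewScaling.
Context {R : realType} {T : finType} {q : nat}.
Implicit Types (H A : op R T q) (t : R).

Lemma adj_skew t H : self_adjoint H ->
  adj ((t%:C * 'i)%C *: H) = - ((t%:C * 'i)%C *: H).
Proof.
move=> sH; rewrite -scaleNr -{2}sH; apply/matrixP => i j.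
rewrite !mxE rmorphM; congr (_ * _).
by apply/eqP; rewrite eq_complex /=; apply/andP; split; apply/eqP; ring.
Qed.

Lemma scale_oppit t H : ((- t)%:C * 'i)%C *: H = - ((t%:C * 'i)%C *: H).
Proof. by rewrite rmorphN mulNr scaleNr. Qed.

Lemma self_adjoint_sum (I : finType) (P : pred I) (f : I -> op R T q) :
  (forall i, self_adjoint (f i)) -> self_adjoint (\sum_(i | P i) f i).
Proof.
move=> sf; apply/matrixP => i j; rewrite mxE !summxE rmorph_sum.
by apply: eq_bigr => k _; rewrite -[in RHS]sf mxE.
Qed.

Lemma comm_sumr (I : finType) (P : pred I) (f : I -> op R T q) A :
  (forall i, P i -> f i *m A = A *m f i) ->
  (\sum_(i | P i) f i) *m A = A *m (\sum_(i | P i) f i).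
Proof. by move=> fA; rewrite mulmx_suml mulmx_sumr; apply: eq_bigr. Qed.

Lemma comm_scale (c c' : R[i]) H H' : H *m H' = H' *m H ->
  (c *: H) *m (c' *: H') = (c' *: H') *m (c *: H).
Proof. by move=> HH; rewrite -!scalemxAl -!scalemxAr HH !scalerA mulrC. Qed.

(** The reversed order makes this product nest against [expm M *m expm N] under conjugation, as
    [conj_cancel] expects. *)
Lemma expm_oppD (M N : op R T q) : M *m N = N *m M ->
  expm (- (M + N)) = expm (- N) *m expm (- M).
Proof.
by move=> MN; rewrite opprD addrC expmD // !mulNmx !mulmxN MN.
Qed.

Lemma conj_cancel (U U' E E' G G' A : op R T q) :
  G *m A = A *m G -> G *m G' = 1%:M ->
  U *m (E *m G) *m A *m (G' *m E' *m U') = U *m (E *m A *m E') *m U'.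
Proof.
move=> GA GG'.
have -> : U *m (E *m G) *m A *m (G' *m E' *m U') =
    U *m (E *m (G *m A *m G') *m E') *m U' by rewrite !mulmxA.
by rewrite GA -(mulmxA A) GG' mulmx1.
Qed.

End SkewScaling.

(** * Comparison of the full and the restricted dynamics *)

Section LocalityOfDynamics.
Context {R : realType} {T : finType} {q : nat}.
Variable (Psi : interaction R T q).

(** Since E E' = 1, E A E' - A is the commutator of E - 1 with A, times E'. The two terms of the
    commutator give the factor 2. *)
Lemma opnorm_conj_sub_le (U U' E E' A : op R T q) :
  opnorm U <= 1 -> opnorm U' <= 1 -> opnorm E' <= 1 -> E *m E' = 1%:M ->
  opnorm (U *m (E *m A *m E') *m U' - U *m A *m U') <= 2 * opnorm A * opnorm (E - 1%:M).
Proof.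
move=> U1 U'1 E'1 EE'.
have -> : U *m (E *m A *m E') *m U' - U *m A *m U' =
    U *m (((E - 1%:M) *m A - A *m (E - 1%:M)) *m E') *m U'.
  rewrite -mulmxBl -mulmxBr; congr (_ *m _ *m _).
  have -> : (E - 1%:M) *m A - A *m (E - 1%:M) = E *m A - A *m E.
    by rewrite mulmxBl mulmxBr mul1mx mulmx1 opprB addrA subrK.
  by rewrite mulmxBl -(mulmxA A) EE' mulmx1.
have contractr (B V : op R T q) : opnorm V <= 1 -> opnorm (B *m V) <= opnorm B.
  by move=> V1; rewrite (le_trans (opnormM _ _)) // -[leRHS]mulr1 ler_wpM2l ?opnorm_ge0.
have contractl (B V : op R T q) : opnorm V <= 1 -> opnorm (V *m B) <= opnorm B.
  by move=> V1; rewrite (le_trans (opnormM _ _)) // -[leRHS]mul1r ler_wpM2r ?opnorm_ge0.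
apply: le_trans (contractr _ _ U'1) _; apply: le_trans (contractl _ _ U1) _.
apply: le_trans (contractr _ _ E'1) _; apply: le_trans (opnormD _ _) _.
rewrite opnormN.
rewrite -mulrA mulr_natl mulr2n; apply: lerD (opnormM _ _).
by rewrite [leRHS]mulrC; exact: opnormM.
Qed.

Lemma tau_sub_le (X L' : {set T}) (A : op R T q) (t : R) :
  is_interaction Psi -> commuting Psi -> local_on X A ->
  opnorm (tau Psi [set: T] t A - tau Psi L' t A)
    <= 2 * opnorm A * `|t| *
       \sum_(Z : {set T} | ~~ [disjoint Z & X] && ~~ [disjoint Z & ~: L'])
          opnorm (Psi Z).
Proof.
move=> iPsi cPsi lA.
have subE (Z : {set T}) : (Z \subset L') = [disjoint Z & ~: L'].
  by rewrite finset.disjoints_subset finset.setCK.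
set S := \sum_(Z | _) _.
pose H := ham Psi L'.
pose W : op R T q := \sum_(Z : {set T} | ~~ [disjoint Z & X] && ~~ [disjoint Z & ~: L']) Psi Z.
pose V : op R T q := \sum_(Z : {set T} | ~~ (Z \subset L') && [disjoint Z & X]) Psi Z.
have hamE : ham Psi [set: T] = H + (W + V).
  rewrite /ham (eq_bigl xpredT); last by move=> Z; rewrite finset.subsetT.
  (* Split first by containment in [L'], then split the rest by whether it meets [X]. *)
  rewrite (bigID (fun Z : {set T} => Z \subset L')) /=; congr (_ + _).
  rewrite (bigID (fun Z : {set T} => [disjoint Z & X])) /= addrC; congr (_ + _).
  by apply: eq_bigl => Z; rewrite subE andbC.
have comm_sums (P Q : pred {set T}) :
    (\sum_(Z | P Z) Psi Z) *m (\sum_(Z | Q Z) Psi Z) =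
    (\sum_(Z | Q Z) Psi Z) *m (\sum_(Z | P Z) Psi Z).
  by apply: comm_sumr => Z _; apply/esym/comm_sumr => Z' _; exact: cPsi.
have HW : H *m W = W *m H by exact: comm_sums.
have HV : H *m V = V *m H by exact: comm_sums.
have WV : W *m V = V *m W by exact: comm_sums.
have VA : V *m A = A *m V.
  apply: comm_sumr => Z /andP[_ ZX]; apply: local_disjoint_comm lA ZX.
  by have [_] := iPsi Z.
have sa (P : pred {set T}) : self_adjoint (\sum_(Z | P Z) Psi Z).
  by apply: self_adjoint_sum => Z; have [] := iPsi Z.
pose c : R[i] := (t%:C * 'i)%C.
have HWV : (c *: H) *m (c *: (W + V)) = (c *: (W + V)) *m (c *: H).
  by apply: comm_scale; rewrite mulmxDl mulmxDr HW HV.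
have cVA : (c *: V) *m A = A *m (c *: V) by rewrite -scalemxAl -scalemxAr VA.
have skew (P : pred {set T}) : adj (c *: \sum_(Z | P Z) Psi Z) = - (c *: \sum_(Z | P Z) Psi Z).
  exact: adj_skew.
have skewN (P : pred {set T}) :
    adj (- (c *: \sum_(Z | P Z) Psi Z)) = - - (c *: \sum_(Z | P Z) Psi Z).
  by rewrite -scale_oppit; apply: adj_skew.
have expH : expm (c *: (H + (W + V))) =
    expm (c *: H) *m (expm (c *: W) *m expm (c *: V)).
  by rewrite scalerDr expmD // scalerDr expmD //; exact: comm_scale.
have expNH : expm (- (c *: (H + (W + V)))) =
    expm (- (c *: V)) *m expm (- (c *: W)) *m expm (- (c *: H)).
  by rewrite scalerDr expm_oppD // scalerDr expm_oppD //; exact: comm_scale.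
have tauE : tau Psi [set: T] t A =
    expm (c *: H) *m (expm (c *: W) *m A *m expm (- (c *: W))) *m expm (- (c *: H)).
  rewrite /tau hamE scale_oppit -/c expH expNH.
  exact: conj_cancel (expm_comm _ _ cVA) (expmN_r _).
rewrite tauE /tau scale_oppit -/c -/H.
apply: le_trans (opnorm_conj_sub_le _ _ _ _ _
  (opnorm_expm_skew _ (skew _)) (opnorm_expm_skew _ (skewN _))
  (opnorm_expm_skew _ (skewN _)) (expmN_r _)) _.
rewrite -[leRHS]mulrA; apply: ler_wpM2l; first by apply: mulr_ge0; rewrite ?opnorm_ge0.
(* Skew-adjointness gives a bound linear in |t|, where the general series estimate would be
   exponential. *)
apply: le_trans (opnorm_expm_skew_sub1 _ (skew _)) _.
apply: le_trans (opnormZ_le _ _) _; rewrite cabs_it.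
by apply: ler_wpM2l; [exact: normr_ge0|exact: opnorm_sum].
Qed.

Lemma sum_crossing_le (e : rel T) (F : R -> R) (X L' : {set T}) : decaying F ->
  \sum_(Z : {set T} | ~~ [disjoint Z & X] && ~~ [disjoint Z & ~: L']) opnorm (Psi Z)
  <= normF e F Psi * \sum_(x in X) \sum_(y in ~: L') F (gdist e x y)%:R.
Proof.
move=> [F0 _].
have pair_le x y : \sum_(Z : {set T} | (x \in Z) && (y \in Z)) opnorm (Psi Z)
    <= normF e F Psi * F (gdist e x y)%:R.
  rewrite -ler_pdivrMr ?F0 ?ler0n //.
  exact: (le_bigmax _ (fun p : T * T =>
    (\sum_(Z : {set T} | (p.1 \in Z) && (p.2 \in Z)) opnorm (Psi Z))
        / F (gdist e p.1 p.2)%:R) (x, y)).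
rewrite mulr_sumr.
have : \sum_(x in X) \sum_(y in ~: L')
    \sum_(Z : {set T} | (x \in Z) && (y \in Z)) opnorm (Psi Z) <=
    \sum_(x in X) normF e F Psi * \sum_(y in ~: L') F (gdist e x y)%:R.
  by apply: ler_sum => x _; rewrite mulr_sumr; apply: ler_sum => y _.
apply: le_trans.
(* Writing membership as an [if] frees the range of [Z], so that the sum over [Z] can be moved
   outside those over [x] and [y]. *)
under [leRHS]eq_bigr => x _.
  under eq_bigr => y _ do rewrite big_mkcond.
  rewrite exchange_big; over.
rewrite [leRHS]exchange_big /= [leLHS]big_mkcond /=; apply: ler_sum => Z _.
have term_ge0 (x y : T) : 0 <= (if (x \in Z) && (y \in Z) then opnorm (Psi Z) else 0 : R).
  by case: ifP => // _; exact: opnorm_ge0.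
case: ifPn => [/andP[]|_]; last first.
  by apply: sumr_ge0 => x _; apply: sumr_ge0 => y _.
(* One pair of sites witnessing the crossing already accounts for [opnorm (Psi Z)]; all other pairs
   add nonnegative terms. *)
move=> /pred0Pn[x /= /andP[xZ xX]] /pred0Pn[y /= /andP[yZ yL]].
rewrite (bigD1 x) //= (bigD1 y) //= xZ yZ /= -addrA lerDl addr_ge0 //.
  by apply: sumr_ge0 => y' _; have := term_ge0 x y'; rewrite xZ.
by apply: sumr_ge0 => x' _; apply: sumr_ge0 => y' _.
Qed.

End LocalityOfDynamics.

Theorem theorem3p7 (R : realType) (T : finType) (q : nat)
  (Psi : interaction R T q) :
  is_interaction Psi -> commuting Psi ->
  forall (X L' : {set T}), X \subset L' ->
  forall A : op R T q, local_on X A ->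
  forall t : R,
    opnorm (tau Psi [set: T] t A - tau Psi L' t A)
      <= 2 * opnorm A * `|t| *
         \sum_(Z : {set T} | ~~ [disjoint Z & X] && ~~ [disjoint Z & ~: L'])
            opnorm (Psi Z)
    /\
    (forall (e : rel T), simple_graph e -> connected_graph e ->
     forall F : R -> R, decaying F ->
     opnorm (tau Psi [set: T] t A - tau Psi L' t A)
       <= 2 * opnorm A * normF e F Psi * `|t| *
          \sum_(x in X) \sum_(y in ~: L') F (gdist e x y)%:R).
Proof.
move=> iPsi cPsi X L' _ A lA t.
have le1 := tau_sub_le Psi X L' A t iPsi cPsi lA.
split=> // e _ _ F dF; rewrite (le_trans le1) //.
have := sum_crossing_le Psi e F X L' dF => le2.
rewrite [leRHS](_ : _ = 2 * opnorm A * `|t| * (normF e F Psi *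
  \sum_(x in X) \sum_(y in ~: L') F (gdist e x y)%:R)); last by ring.
by rewrite ler_wpM2l // !mulr_ge0 ?opnorm_ge0.
Qed.
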